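(* Let $d_a(\bm p_{sa},\overline{\bm p}_{sa})=\sum_{s'\in\mathcal{S}}\overline p_{sas'}\,\phi(p_{sas'}/\overline p_{sas'})$ with the Kullback-Leibler divergence $\phi(t)=t\log t-t+1$. If $\beta\ge\min\{\bm b\}+\omega$ for some $\omega>0$, then the projection problem $$\mathfrak{P}(\overline{\bm p}_{sa};\bm b,\beta)=\min\{d_a(\bm p_{sa},\overline{\bm p}_{sa}):\ \bm b^\top\bm p_{sa}\le\beta,\ \bm p_{sa}\in\Delta_S\}$$ can be solved to $\delta$-accuracy in time $\mathcal{O}\big(S\cdot\log[\max\{\bm b\}\cdot\log(\min\{\overline{\bm p}\}^{-1})/(\delta\omega)]\big)$.
   Context: $\mathcal{S}=\{1,\dots,S\}$; $\Delta_S=\{\bm p\in\mathbb{R}^S_+:\mathbf{e}^\top\bm p=1\}$ is the probability simplex; $\overline{\bm p}_{sa}\in\Delta_S$ with $\overline{\bm p}_{sa}>\bm 0$ component-wise; $\bm b\in\mathbb{R}^S_+$, $\beta\in\mathbb{R}_+$; $\min\{\bm b\}$ and $\max\{\bm b\}$ are the smallest and largest components of $\bm b$, and $\min\{\overline{\bm p}\}$ is the smallest component of $\overline{\bm p}_{sa}$. The convention $0\log0=0$ is used. The projection problem is solved to $\delta$-accuracy ($\delta>0$) by any pair $(\underline d,\overline d)\in\mathbb{R}^2$ with $\mathfrak{P}(\overline{\bm p}_{sa};\bm b,\beta)\in[\underline d,\overline d]$ and $\overline d-\underline d\le\delta$. Time counts elementary operations (arithmetic, comparisons, and evaluations of $\exp$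 and $\log$). *)

(* Defs.v *)
(* MathComp-Analysis; the reals are an arbitrary R : realType. *)
From HB Require Import structures.
From mathcomp Require Import all_boot all_order all_algebra.
From mathcomp Require Import all_classical all_reals all_analysis.

Set Implicit Arguments.
Unset Strict Implicit.
Unset Printing Implicit Defensive.

Import Order.TTheory GRing.Theory Num.Theory.
Import numFieldNormedType.Exports.

Local Open Scope classical_set_scope.
Local Open Scope ring_scope.

Section Projection.
Context {R : realType} {n : nat}.
(* The index set {1, ..., S} is 'I_S with S = n.+1, as the simplex is empty
   for S = 0. *)
Implicit Types x p q pbar b : 'I_n.+1 -> R.

Definition vmin x : R := \big[Order.min/x ord0]_(i < n.+1) x i.
Definition vmax x : R := \big[Order.max/x ord0]_(i < n.+1) x i.

Definition simplex : set ('I_n.+1 -> R) :=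
  [set p | (forall i, 0 <= p i) /\ \sum_(i < n.+1) p i = 1].

(* [ln 0] is a real number, so [kl_phi 0 = 1], i.e. 0 log 0 = 0. *)
Definition kl_phi (t : R) : R := t * ln t - t + 1.

Definition kl_div p q : R := \sum_(i < n.+1) q i * kl_phi (p i / q i).

Definition proj_feasible b (beta : R) : set ('I_n.+1 -> R) :=
  [set p | simplex p /\ \sum_(i < n.+1) b i * p i <= beta].

Definition is_minimum (A : set R) (v : R) : Prop := A v /\ lbound A v.

Definition is_projection_value pbar b (beta v : R) : Prop :=
  is_minimum [set kl_div p pbar | p in proj_feasible b beta] v.

Definition delta_accurate pbar b (beta delta dlo dhi : R) : Prop :=
  (exists v, is_projection_value pbar b beta v /\ dlo <= v <= dhi) /\
  dhi - dlo <= delta.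

End Projection.

(* Real random-access machine: structured programs over countably many real
   variables, index (natural number) variables and real arrays.  The syntax is
   first order and does not mention R, so that a program cannot hide any
   uncounted computation, its only constants are natural numbers, and one
   program has to serve all dimensions.  There is no rounding and no conversion
   from reals to indices. *)

Inductive iexpr : Type :=
| IConst of nat
| IVar of nat
| IAdd of iexpr & iexpr.

Inductive rexpr : Type :=
| RConst of nat
| RVar of nat
| RGet of nat & iexpr        (* RGet a e: entry number e of array a *)
| RAdd of rexpr & rexpr
| RSub of rexpr & rexpr
| RMul of rexpr & rexpr
| RDiv of rexpr & rexpr
| RExp of rexpr
| RLog of rexpr.

Inductive test : Type :=
| ILt of iexpr & iexpr
| RLe of rexpr & rexpr
| RLt of rexpr & rexpr.

Inductive prog : Type :=
| Skip
| ISet of nat & iexpr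
| RSet of nat & rexpr
| RPut of nat & iexpr & rexpr  (* RPut a e x: store x as entry e of array a *)
| Seq of prog & prog
| If of test & prog & prog
| While of test & prog.

(* Every constant, memory access, arithmetic operation, exp, log and comparison
   costs one unit. *)
Fixpoint icost (e : iexpr) : nat :=
  match e with
  | IConst _ | IVar _ => 1
  | IAdd e1 e2 => (icost e1 + icost e2).+1
  end.

Fixpoint rcost (e : rexpr) : nat :=
  match e with
  | RConst _ | RVar _ => 1
  | RGet _ i => (icost i).+1
  | RAdd e1 e2 | RSub e1 e2 | RMul e1 e2 | RDiv e1 e2 =>
      (rcost e1 + rcost e2).+1
  | RExp e1 | RLog e1 => (rcost e1).+1
  end.

Definition tcost (t : test) : nat :=
  match t with
  | ILt e1 e2 => (icost e1 + icost e2).+1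
  | RLe e1 e2 | RLt e1 e2 => (rcost e1 + rcost e2).+1
  end.

Section Semantics.
Context {R : realType}.

Record state := State {
  ivar : nat -> nat;
  rvar : nat -> R;
  array : nat -> nat -> R }.

Definition upd (T : Type) (f : nat -> T) (k : nat) (v : T) : nat -> T :=
  fun j => if j == k then v else f j.

Fixpoint ieval (s : state) (e : iexpr) : nat :=
  match e with
  | IConst k => k
  | IVar x => ivar s x
  | IAdd e1 e2 => (ieval s e1 + ieval s e2)%N
  end.

(* Division by zero and the logarithm of a non-positive number take the total
   values of the library ([x / 0 = 0], [ln x = 0] for [x <= 0]). *)
Fixpoint reval (s : state) (e : rexpr) : R :=
  match e with
  | RConst k => k%:R
  | RVar x => rvar s x
  | RGet a i => array s a (ieval s i)
  | RAdd e1 e2 => reval s e1 + reval s e2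
  | RSub e1 e2 => reval s e1 - reval s e2
  | RMul e1 e2 => reval s e1 * reval s e2
  | RDiv e1 e2 => reval s e1 / reval s e2
  | RExp e1 => expR (reval s e1)
  | RLog e1 => ln (reval s e1)
  end.

Definition teval (s : state) (t : test) : bool :=
  match t with
  | ILt e1 e2 => (ieval s e1 < ieval s e2)%N
  | RLe e1 e2 => reval s e1 <= reval s e2
  | RLt e1 e2 => reval s e1 < reval s e2
  end.

(* [exec c s t s']: from [s], program [c] halts in [s'] after [t] steps. *)
Inductive exec : prog -> state -> nat -> state -> Prop :=
| exec_skip s : exec Skip s 1%N s
| exec_iset s x e :
    exec (ISet x e) s (icost e).+1
      (State (upd (ivar s) x (ieval s e)) (rvar s) (array s))
| exec_rset s x e :
    exec (RSet x e) s (rcost e).+1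
      (State (ivar s) (upd (rvar s) x (reval s e)) (array s))
| exec_rput s a i e :
    exec (RPut a i e) s (icost i + rcost e).+1
      (State (ivar s) (rvar s)
         (upd (array s) a (upd (array s a) (ieval s i) (reval s e))))
| exec_seq c1 c2 s s1 s2 t1 t2 :
    exec c1 s t1 s1 -> exec c2 s1 t2 s2 ->
    exec (Seq c1 c2) s (t1 + t2)%N s2
| exec_if_true b c1 c2 s s1 t :
    teval s b -> exec c1 s t s1 -> exec (If b c1 c2) s (tcost b + t)%N s1
| exec_if_false b c1 c2 s s1 t :
    ~~ teval s b -> exec c2 s t s1 -> exec (If b c1 c2) s (tcost b + t)%N s1
| exec_while_true b c s s1 s2 t1 t2 :
    teval s b -> exec c s t1 s1 -> exec (While b c) s1 t2 s2 ->
    exec (While b c) s (tcost b + t1 + t2)%N s2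
| exec_while_false b c s :
    ~~ teval s b -> exec (While b c) s (tcost b) s.

Lemma exec_deterministic c s t1 s1 t2 s2 :
  exec c s t1 s1 -> exec c s t2 s2 -> t1 = t2 /\ s1 = s2.
Proof.
move=> h1; elim: h1 t2 s2 => {c s t1 s1}.
- by move=> s t2 s2 h; inversion h.
- by move=> s x e t2 s2 h; inversion h.
- by move=> s x e t2 s2 h; inversion h.
- by move=> s a i e t2 s2 h; inversion h.
- move=> c1 c2 s s1 s2 t1 t2 _ ih1 _ ih2 t s' h; inversion h; subst.
  match goal with H : exec c1 s _ _ |- _ => case: (ih1 _ _ H) => ? ? end.
  subst.
  match goal with H : exec c2 _ _ s' |- _ => by case: (ih2 _ _ H) => -> -> end.
- move=> b c1 c2 s s1 t hb _ ih t' s' h; inversion h; subst.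
    by match goal with H : exec c1 s _ _ |- _ => case: (ih _ _ H) => -> -> end.
  by match goal with H : is_true (~~ _) |- _ => rewrite hb in H end.
- move=> b c1 c2 s s1 t hb _ ih t' s' h; inversion h; subst.
    by match goal with H : is_true (teval _ _) |- _ => rewrite H in hb end.
  by match goal with H : exec c2 s _ _ |- _ => case: (ih _ _ H) => -> -> end.
- move=> b c s s1 s2 t1 t2 hb _ ih1 _ ih2 t s' h; inversion h; subst; last first.
    by match goal with H : is_true (~~ _) |- _ => rewrite hb in H end.
  match goal with H : exec c s _ _ |- _ => case: (ih1 _ _ H) => ? ? end.
  subst.
  match goal with H : exec (While b c) _ _ s' |- _ =>
    by case: (ih2 _ _ H) => -> -> end.
- move=> b c s hb t s' h; inversion h; subst => //.
  by match goal with H : is_true (teval _ _) |- _ => rewrite H in hb end.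
Qed.

(* A vector is stored in the entries 0, ..., S - 1 of an array, followed by
   zeros. *)
Definition vec_array (n : nat) (x : 'I_n.+1 -> R) : nat -> R :=
  fun k => oapp x 0 (insub k).

(* The input is S in index variable 0, beta and delta in real variables 0 and
   1, pbar and b in arrays 0 and 1; everything else is zero. *)
Definition input (n : nat) (pbar b : 'I_n.+1 -> R) (beta delta : R) : state :=
  State (upd (fun=> 0%N) 0%N n.+1)
        (upd (upd (fun=> 0) 0%N beta) 1%N delta)
        (upd (upd (fun=> fun=> 0) 0%N (vec_array pbar)) 1%N (vec_array b)).

(* The pair returned is read off real variables 0 and 1. *)
Definition solves_in_time (c : prog) (n : nat) (pbar b : 'I_n.+1 -> R)
    (beta delta : R) (t : nat) : Prop :=
  exists s : state, exec c (input pbar b beta delta) t s /\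
    delta_accurate pbar b beta delta (rvar s 0%N) (rvar s 1%N).

End Semantics.

Arguments state : clear implicits.

(* The bound S * log[...] whose multiples are meant by O(S * log[...]) for all
   inputs: the argument of the logarithm may be at most 1, whereas a run takes
   at least one step, hence the maximum with 1. *)
Definition time_bound {R : realType} (n : nat) (pbar b : 'I_n.+1 -> R)
    (delta omega : R) : R :=
  n.+1%:R *
  Num.max 1 (ln ((vmax b * ln ((vmin pbar)^-1)) / (delta * omega))).

(* Main.v *)
Require Import Defs.
From mathcomp Require Import all_boot all_order all_algebra.
From mathcomp Require Import all_classical all_reals all_analysis.
From mathcomp Require Import ring lra zify.

Import Order.TTheory GRing.Theory Num.Theory.
Import numFieldNormedType.Exports.

Set Implicit Arguments.
Unset Strict Implicit.
Unset Printing Implicit Defensive.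

Local Open Scope ring_scope.

(** The projection value is computed through the dual of the problem.  For a
    multiplier [a >= 0] of the constraint [b^T p <= beta], minimising the
    Lagrangian over the simplex gives the tilted distribution, proportional to
    [pbar i * e^(- a b_i)], and the concave dual function
    [- beta a - ln Z(a)], with [Z] the partition function.  The derivative of the
    dual has the sign of [excess a = sum_i pbar_i e^(- a b_i) (b_i - beta)], so
    an optimal multiplier is [0] if [excess 0 <= 0], and otherwise a zero of
    [excess], which bisection encloses.

    No differentiation is needed.  The Fenchel-Young inequality
    [kl_phi_young] for the scalar divergence, an equality at [t = e^u], yields
    weak duality ([kl_div_ge_dual]) and its tightness at tilted distributions
    ([kl_div_tilt]); complementary slackness then certifies the optimum
    ([dual_value]), and the intermediate value theorem supplies a zero of
    [excess] between two multipliers of opposite signs.  On a bracket [a, c]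
    the value lies in an interval of length [max b * (c - a)] starting at
    [dual a] ([projection_value_bracket]), since the dual has slope at most
    [max b].

    The first bracket is [0, ln (1 / min pbar) / (beta - min b)]
    ([excess_upper_end]): the dual vanishes at its left end and is nonpositive at
    its right end, so by concavity it does not increase there.  Its length is at most
    [ln (1 / min pbar) / omega], hence a number of halvings logarithmic in
    [max b * ln (1 / min pbar) / (delta omega)] brings the interval below
    [delta].  A halving evaluates [excess] once, in a pass of linear length over
    the data.  The program computes [beta - min b] and never sees [omega].

    Running times are tracked by a total-correctness logic with a step budget
    ([halts]); [halts_sweep] treats all passes over the data at once, and
    [halts_while] all loops. *)

(** * Minima and maxima of vectors *)

Lemma vmax_ge (R : realType) (n : nat) (x : 'I_n.+1 -> R) i : x i <= vmax x.
Proof. exact: le_bigmax. Qed.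

Lemma vmin_le (R : realType) (n : nat) (x : 'I_n.+1 -> R) i : vmin x <= x i.
Proof. exact: bigmin_le. Qed.

Lemma vmin_attained (R : realType) (n : nat) (x : 'I_n.+1 -> R) :
  exists i, vmin x = x i.
Proof.
rewrite /vmin; elim/big_ind: _ => [|u v [i ->] [j ->]|i _]; try by eexists.
by case: leP => _; eexists.
Qed.

(** * Lagrangian duality *)

(** Fenchel-Young, the convex conjugate of [kl_phi] being [e^u - 1]. For [0 < t]
    it is [1 + y <= e^y] at [y = u - ln t], multiplied by [t]. *)
Lemma kl_phi_young (R : realType) (t u : R) :
  0 <= t -> t * u - expR u + 1 <= kl_phi t.
Proof.
rewrite /kl_phi le_eqVlt => /predU1P[<-|t0].
  by have := expR_gt0 u; lra.
have := expR_ge1Dx (u - ln t).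
rewrite expRB (lnK t0) -(ler_pM2l t0) mulrCA divff ?gt_eqF// mulr1.
by lra.
Qed.

Lemma kl_phi_expR (R : realType) (u : R) :
  kl_phi (expR u) = expR u * u - expR u + 1.
Proof. by rewrite /kl_phi expRK. Qed.

Section DualFunction.
Context {R : realType} {n : nat}.
Variables (pbar b : 'I_n.+1 -> R) (beta : R).

Definition partition_fun (a : R) : R :=
  \sum_(i < n.+1) pbar i * expR (- (a * b i)).

(** The derivative of [dual], times the positive factor [partition_fun]. *)
Definition excess (a : R) : R :=
  \sum_(i < n.+1) pbar i * expR (- (a * b i)) * (b i - beta).

Definition dual (a : R) : R := - (beta * a) - ln (partition_fun a).

Definition tilt (a : R) (i : 'I_n.+1) : R :=
  pbar i * expR (- (a * b i)) / partition_fun a.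

Hypotheses (pbar_simplex : simplex pbar) (pbar_gt0 : forall i, 0 < pbar i).

Lemma partition_gt0 a : 0 < partition_fun a.
Proof.
rewrite /partition_fun big_ord_recl ltr_wpDr//; last first.
  by rewrite mulr_gt0 ?expR_gt0.
by rewrite sumr_ge0// => i _; rewrite mulr_ge0 ?expR_ge0// ltW.
Qed.

Lemma tilt_simplex a : simplex (tilt a).
Proof.
split=> [i|].
  by rewrite divr_ge0 ?mulr_ge0 ?expR_ge0 ?ltW ?partition_gt0.
by rewrite -mulr_suml divff// gt_eqF ?partition_gt0.
Qed.

Lemma tilt_excess a :
  \sum_(i < n.+1) b i * tilt a i - beta = excess a / partition_fun a.
Proof.
have -> : excess a = \sum_(i < n.+1) b i * (pbar i * expR (- (a * b i)))
                     - beta * partition_fun a.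
  rewrite /excess /partition_fun mulr_sumr -sumrB.
  by apply: eq_bigr => i _; ring.
rewrite mulrBl mulfK ?gt_eqF ?partition_gt0// mulr_suml.
by congr (_ - _); apply: eq_bigr => i _; rewrite /tilt; ring.
Qed.

Lemma tilt_ratio a i :
  tilt a i / pbar i = expR (- (a * b i) - ln (partition_fun a)).
Proof.
rewrite expRB (lnK (partition_gt0 a)) /tilt.
by field; rewrite !gt_eqF ?partition_gt0.
Qed.

(** The Fenchel-Young bound at [u_i = ln (tilt a i / pbar i)], summed with the
    weights [pbar]: the terms [e^(u_i)] add up to the mass of the tilted
    distribution and cancel that of [pbar]. *)
Lemma sum_young_bound a p : simplex p ->
  \sum_(i < n.+1) pbar i *
     (p i / pbar i * (- (a * b i) - ln (partition_fun a))
      - expR (- (a * b i) - ln (partition_fun a)) + 1)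
  = - (a * \sum_(i < n.+1) b i * p i) - ln (partition_fun a).
Proof.
move=> [_ p1].
transitivity (\sum_(i < n.+1) (- a * (b i * p i)
   - ln (partition_fun a) * p i - tilt a i + pbar i)).
  apply: eq_bigr => i _; rewrite -tilt_ratio.
  by field; rewrite gt_eqF.
rewrite big_split /= !sumrB -!mulr_sumr p1 (tilt_simplex a).2 pbar_simplex.2.
by ring.
Qed.

(** Weak duality, before the constraint on [b^T p] is used. *)
Lemma kl_div_ge_dual a p : simplex p ->
  - (a * \sum_(i < n.+1) b i * p i) - ln (partition_fun a) <= kl_div p pbar.
Proof.
move=> sp; rewrite -sum_young_bound//; apply: ler_sum => i _.
by rewrite ler_pM2l//; apply: kl_phi_young; rewrite divr_ge0 ?sp.1// ltW.
Qed.

(** Fenchel-Young is an equality when [t = e^u], and the ratios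
    [tilt a i / pbar i] are the exponentials of the slopes [u_i] above. *)
Lemma kl_div_tilt a :
  kl_div (tilt a) pbar =
  - (a * \sum_(i < n.+1) b i * tilt a i) - ln (partition_fun a).
Proof.
rewrite -sum_young_bound; last exact: tilt_simplex.
by apply: eq_bigr => i _; rewrite tilt_ratio kl_phi_expR.
Qed.

Lemma partition_fun0 : partition_fun 0 = 1.
Proof.
rewrite -[RHS]pbar_simplex.2; apply: eq_bigr => i _.
by rewrite mul0r oppr0 expR0 mulr1.
Qed.

Lemma dual0 : dual 0 = 0.
Proof. by rewrite /dual partition_fun0 ln1; ring. Qed.

Lemma kl_div_ge0 p : simplex p -> 0 <= kl_div p pbar.
Proof.
move=> sp; apply: le_trans (kl_div_ge_dual 0 sp).
by rewrite partition_fun0 ln1; lra.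
Qed.

(** The tilted distribution is feasible, and by complementary slackness its
    divergence equals the lower bound given by weak duality. *)
Lemma dual_value a : 0 <= a -> excess a <= 0 -> a * excess a = 0 ->
  is_projection_value pbar b beta (dual a).
Proof.
move=> a0 ea0 compl; have Z0 := partition_gt0 a.
have te := tilt_excess a; split.
  exists (tilt a).
    split; first exact: tilt_simplex.
    by rewrite -subr_le0 te pmulr_lle0 ?invr_gt0.
  have : a * (\sum_(i < n.+1) b i * tilt a i - beta) = 0.
    by rewrite te mulrA compl mul0r.
  by rewrite kl_div_tilt /dual; lra.
move=> _ [p [sp bp] <-]; apply: (le_trans _ (kl_div_ge_dual a sp)).
by have := ler_wpM2l a0 bp; rewrite /dual; lra.
Qed.

Lemma continuous_excess : continuous (excess : R -> R).
Proof.
apply: continuous_big => [|i _ x]; first exact: add_continuous.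
apply: cvgMr_tmp; apply: cvgMl_tmp.
apply: (continuous_comp (f := fun a : R => - (a * b i))).
  by apply: cvgN; apply: cvgMr_tmp.
exact: continuous_expR.
Qed.

(** The value is [dual r] for some zero [r] of [excess] in the bracket. The
    lower bound is weak duality; for the upper one, lowering the multiplier from
    [r] to [a] multiplies each term of the partition function by at most
    [e^((r - a) max b)]. *)
Lemma projection_value_bracket a c : 0 <= a -> a <= c -> 0 <= beta -> 0 <= vmax b ->
  0 <= excess a -> excess c <= 0 ->
  exists v, is_projection_value pbar b beta v /\
    dual a <= v <= dual a + vmax b * (c - a).
Proof.
move=> a0 ac beta0 bmax0 ea ec.
have [] := @IVT _ excess a c 0 ac.
- exact/continuous_subspaceT/continuous_excess.
- by rewrite ge_min le_max ec ea orbT.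
move=> r; rewrite in_itv/= => /andP[ar rc] er.
have r0 : 0 <= r by exact: le_trans ar.
have val : is_projection_value pbar b beta (dual r).
  by apply: dual_value; rewrite ?er// mulr0.
exists (dual r); split=> //; apply/andP; split.
  have fr : proj_feasible b beta (tilt r).
    by split; [exact: tilt_simplex|rewrite -subr_le0 tilt_excess er mul0r].
  rewrite [leRHS](_ : _ = kl_div (tilt r) pbar); last first.
    have := tilt_excess r; rewrite er mul0r kl_div_tilt /dual => /subr0_eq ->.
    by rewrite mulrC.
  apply: le_trans (kl_div_ge_dual a (tilt_simplex r)).
  by have := ler_wpM2l a0 fr.2; rewrite /dual; lra.
have b_le i : b i <= vmax b by exact: le_bigmax.
have b_ge0 : 0 <= (r - a) * beta by rewrite mulr_ge0 ?subr_ge0.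
have Zle : partition_fun a * expR (- ((r - a) * vmax b)) <= partition_fun r.
  rewrite /partition_fun mulr_suml; apply: ler_sum => i _.
  rewrite -mulrA -expRD ler_pM2l// ler_expR.
  have := ler_wpM2l (_ : 0 <= r - a) (b_le i); rewrite subr_ge0 => /(_ ar).
  by lra.
have := Zle; rewrite -ler_ln ?posrE ?mulr_gt0 ?partition_gt0 ?expR_gt0//.
rewrite lnM ?posrE ?partition_gt0 ?expR_gt0// expRK /dual.
have := ler_wpM2r bmax0 rc; lra.
Qed.

Lemma simplex_le1 i : pbar i <= 1.
Proof.
by rewrite -pbar_simplex.2 (bigD1 i)//= lerDl sumr_ge0// => l _; rewrite ltW.
Qed.

Lemma ln_vmin_inv_ge0 : 0 <= ln (vmin pbar)^-1.
Proof.
by have [k ->] := vmin_attained pbar; rewrite ln_ge0// invf_ge1// simplex_le1.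
Qed.

(** With [j] an argument of the minimum of [b], keeping the term [j] alone in
    the partition function bounds [dual A] above by
    [- ln (pbar j) - A (beta - b j) <= 0]. The divergence of the tilted
    distribution is [dual A + A (beta - m)], with [m] the mean of [b] under it;
    as a divergence is nonnegative, [m <= beta] provided [A <> 0]. *)
Lemma excess_upper_end : vmin b < beta -> 0 < excess 0 ->
  0 <= ln (vmin pbar)^-1 / (beta - vmin b) /\
  excess (ln (vmin pbar)^-1 / (beta - vmin b)) <= 0.
Proof.
set A := ln _ / _ => bb e0.
have [j bj] := vmin_attained b.
have [k pk] := vmin_attained pbar.
have m0 : 0 < vmin pbar by rewrite pk.
have gap0 : 0 < beta - vmin b by rewrite subr_gt0.
have A0 : 0 <= A by rewrite divr_ge0 ?ln_vmin_inv_ge0// ltW.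
split=> //.
have AL : A * (beta - vmin b) = - ln (vmin pbar).
  by rewrite divfK ?gt_eqF// lnV.
(* If A = 0, all weights are 1, the index set is a singleton and excess 0 is
   vmin b - beta < 0. *)
have ApA : A != 0.
  apply/eqP => A_eq0; move: AL; rewrite A_eq0 mul0r => /esym/eqP.
  rewrite oppr_eq0 ln_eq0// => /eqP m1.
  have p1 i : pbar i = 1 by apply/le_anti; rewrite simplex_le1/= -m1 vmin_le.
  have n0 : n = 0%N.
    have := pbar_simplex.2; rewrite (eq_bigr (fun=> 1)) => [|i _]; last exact: p1.
    rewrite sumr_const card_ord => /eqP; rewrite (eqr_nat R n.+1 1) => /eqP[].
    by [].
  move: e0; rewrite /excess (bigD1 j)//= big1 => [|i].
    by rewrite mul0r oppr0 expR0 p1 -bj; lra.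
  have lt1 (l : 'I_n.+1) : (l < 1)%N by apply: leq_trans (ltn_ord l) _; rewrite n0.
  case/eqP; apply: val_inj => /=.
  by have := lt1 i; have := lt1 j; rewrite !ltnS !leqn0 => /eqP-> /eqP->.
have Z0 := partition_gt0 A.
have : ln (pbar j * expR (- (A * b j))) <= ln (partition_fun A).
  rewrite ler_ln ?posrE ?mulr_gt0 ?expR_gt0// /partition_fun (bigD1 j)//= lerDl.
  by rewrite sumr_ge0// => l _; rewrite mulr_ge0 ?expR_ge0 ?ltW.
rewrite lnM ?posrE ?expR_gt0// expRK -bj => lnZ.
have lnj : ln (vmin pbar) <= ln (pbar j) by rewrite ler_ln ?posrE// vmin_le.
have := kl_div_ge0 (tilt_simplex A).
rewrite kl_div_tilt => kl0.
have : A * (\sum_(i < n.+1) b i * tilt A i - beta) <= 0 by lra.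
rewrite tilt_excess pmulr_rle0 ?lt0r ?ApA//.
by rewrite pmulr_lle0 // invr_gt0.
Qed.
End DualFunction.

(** * Total correctness within a step budget *)

Section TotalCorrectness.
Context {R : realType}.

Definition halts (c : prog) (s : state R) (T : nat) (Q : state R -> Prop) :=
  exists t s', [/\ exec c s t s', (t <= T)%N & Q s'].

Lemma halts_le T c s T' Q : halts c s T Q -> (T <= T')%N -> halts c s T' Q.
Proof.
move=> [t [s' [cs tT Qs']]] TT'; exists t, s'; split=> //.
exact: leq_trans TT'.
Qed.

Lemma halts_post c s T (Q Q' : state R -> Prop) :
  halts c s T Q -> (forall s', Q s' -> Q' s') -> halts c s T Q'.
Proof. by move=> [t [s' [cs tT /[swap] /[apply]]]] ?; exists t, s'. Qed.

Lemma halts_skip s (Q : state R -> Prop) : Q s -> halts Skip s 1 Q.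
Proof. by move=> Qs; exists 1%N, s; split=> //; exact: exec_skip. Qed.

Lemma halts_iset x e s (Q : state R -> Prop) :
  Q (State (upd (ivar s) x (ieval s e)) (rvar s) (array s)) ->
  halts (ISet x e) s (icost e).+1 Q.
Proof. by move=> ?; do 2 eexists; split; [exact: exec_iset| |]. Qed.

Lemma halts_rset x e s (Q : state R -> Prop) :
  Q (State (ivar s) (upd (rvar s) x (reval s e)) (array s)) ->
  halts (RSet x e) s (rcost e).+1 Q.
Proof. by move=> ?; do 2 eexists; split; [exact: exec_rset| |]. Qed.

Lemma halts_seq T1 T2 c1 c2 s Q :
  halts c1 s T1 (fun s1 => halts c2 s1 T2 Q) -> halts (Seq c1 c2) s (T1 + T2) Q.
Proof.
move=> [t1 [s1 [e1 l1 [t2 [s2 [e2 l2 Qs2]]]]]].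
exists (t1 + t2)%N, s2; split=> //; last exact: leq_add.
exact: exec_seq e1 e2.
Qed.

Lemma halts_if T b c1 c2 s Q :
  (teval s b -> halts c1 s T Q) -> (~~ teval s b -> halts c2 s T Q) ->
  halts (If b c1 c2) s (tcost b + T) Q.
Proof.
move=> h1 h2; have [sb|sb] := boolP (teval s b).
  have [t [s' [e l Qs']]] := h1 sb.
  by exists (tcost b + t)%N, s'; rewrite leq_add2l; split=> //; exact: exec_if_true.
have [t [s' [e l Qs']]] := h2 sb.
by exists (tcost b + t)%N, s'; rewrite leq_add2l; split=> //; exact: exec_if_false.
Qed.

(** The index of the invariant is a variant: it bounds the number of iterations
    left, and a loop may stop before it reaches [0]. *)
Lemma halts_while (I : nat -> state R -> Prop) T b c :
  (forall s, I 0%N s -> ~~ teval s b) ->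
  (forall k s, I k.+1 s -> teval s b -> halts c s T (I k)) ->
  forall k s, I k s ->
    halts (While b c) s (k * (tcost b + T) + tcost b)
      (fun s' => ~~ teval s' b /\ exists k', I k' s').
Proof.
move=> I0 IS; elim=> [|k ih] s Is; have [sb|sb] := boolP (teval s b).
- by have := I0 _ Is; rewrite sb.
- exists (tcost b), s; split=> //; first exact: exec_while_false.
  by split=> //; exists 0%N.
- have [t1 [s1 [e1 l1 /ih[t2 [s2 [e2 l2 Q2]]]]]] := IS _ _ Is sb.
  exists (tcost b + t1 + t2)%N, s2; split=> //.
    exact: exec_while_true e1 e2.
  by rewrite mulSn -[leqRHS]addnA leq_add// leq_add2l.
- exists (tcost b), s; split=> //; first exact: exec_while_false.
    by rewrite leq_addl.
  by split=> //; exists k.+1.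
Qed.

Lemma upd_same (T : Type) (f : nat -> T) k v : upd f k v k = v.
Proof. by rewrite /upd eqxx. Qed.

Lemma upd_upd (T : Type) (f : nat -> T) k u v : upd (upd f k u) k v = upd f k v.
Proof. by apply/funext => j; rewrite /upd; case: eqP. Qed.

End TotalCorrectness.

(** * The bisection program *)

Section Program.

Notation BETA := 0%N.
Notation DELTA := 1%N.
Notation BMIN := 2%N.
Notation BMAX := 3%N.
Notation PMIN := 4%N.
Notation LO := 5%N.
Notation HI := 6%N.
Notation MID := 7%N.
Notation EXCESS := 8%N.
Notation MASS := 9%N.
(* The answer overwrites the registers of beta and delta. *)
Notation DLO := 0%N.
Notation DHI := 1%N.

Notation DIM := 0%N.
Notation IDX := 1%N.

Definition pbar_entry := RGet 0 (IVar IDX).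
Definition b_entry := RGet 1 (IVar IDX).

Definition sweep (x : nat) (init : rexpr) (body : prog) : prog :=
  Seq (RSet x init)
  (Seq (ISet IDX (IConst 0))
  (While (ILt (IVar IDX) (IVar DIM))
     (Seq body (ISet IDX (IAdd (IVar IDX) (IConst 1)))))).

Definition sweep_min x a : prog :=
  sweep x (RGet a (IConst 0))
    (If (RLt (RGet a (IVar IDX)) (RVar x)) (RSet x (RGet a (IVar IDX))) Skip).

Definition sweep_max x a : prog :=
  sweep x (RGet a (IConst 0))
    (If (RLt (RGet a (IVar IDX)) (RVar x)) Skip (RSet x (RGet a (IVar IDX)))).

Definition sweep_sum x e : prog :=
  sweep x (RConst 0) (RSet x (RAdd e (RVar x))).

(** The multiplier is read from [MID], also outside the bisection loop. *)
Definition tilted_entry : rexpr :=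
  RMul pbar_entry (RExp (RSub (RConst 0) (RMul (RVar MID) b_entry))).

Definition compute_mass : prog := sweep_sum MASS tilted_entry.

Definition compute_excess : prog :=
  sweep_sum EXCESS (RMul tilted_entry (RSub b_entry (RVar BETA))).

Definition halve : prog :=
  Seq (RSet MID (RDiv (RAdd (RVar LO) (RVar HI)) (RConst 2)))
  (Seq compute_excess
  (If (RLe (RConst 0) (RVar EXCESS))
      (RSet LO (RVar MID))
      (RSet HI (RVar MID)))).

(** The length of the enclosure of the value that the bracket yields. *)
Definition width : rexpr := RMul (RVar BMAX) (RSub (RVar HI) (RVar LO)).

Definition bisect : prog := While (RLt (RVar DELTA) width) halve.

Definition report : prog :=
  Seq (RSet MID (RVar LO))
  (Seq compute_mass
  (Seq (RSet DLO (RSub (RSub (RConst 0) (RMul (RVar BETA) (RVar LO)))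
                       (RLog (RVar MASS))))
       (RSet DHI (RAdd (RVar DLO) width)))).

(** At multiplier [0] the excess is [b^T pbar - beta]; when it is nonpositive,
    [pbar] itself is feasible and the value is [0]. *)
Definition projection_solver : prog :=
  Seq (sweep_min BMIN 1)
  (Seq (sweep_max BMAX 1)
  (Seq (sweep_min PMIN 0)
  (Seq (RSet MID (RConst 0))
  (Seq compute_excess
  (If (RLe (RVar EXCESS) (RConst 0))
      (Seq (RSet DLO (RConst 0)) (RSet DHI (RConst 0)))
      (Seq (RSet LO (RConst 0))
      (Seq (RSet HI (RDiv (RLog (RDiv (RConst 1) (RVar PMIN)))
                          (RSub (RVar BETA) (RVar BMIN))))
      (Seq bisect report)))))))).

(** * Correctness and cost of the program *)

Context {R : realType} {n : nat}.
Variables (pbar b : 'I_n.+1 -> R) (beta delta : R).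

Lemma vec_array_ord (x : 'I_n.+1 -> R) (i : 'I_n.+1) : vec_array x i = x i.
Proof. by rewrite /vec_array valK. Qed.

Lemma vec_array0 (x : 'I_n.+1 -> R) : vec_array x 0%N = x ord0.
Proof. exact: (vec_array_ord x ord0). Qed.

Lemma big_prefix_step (op : SemiGroup.com_law R) (z : R) (F : 'I_n.+1 -> R)
    (k : 'I_n.+1) :
  \big[op/z]_(i < n.+1 | (i < k.+1)%N) F i =
  op (F k) (\big[op/z]_(i < n.+1 | (i < k)%N) F i).
Proof.
rewrite (bigD1 k)//=; congr (op _ _); apply: eq_bigl => i.
by rewrite ltnS andbC [RHS]ltn_neqAle.
Qed.

(** Minima, maxima and sums are folds of a commutative semigroup law, so one
    lemma serves every pass. The invariant says that after [k] iterations
    register [x] holds the fold over the entries below [k]. *)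
Lemma halts_sweep (op : SemiGroup.com_law R) x init body T s (F : 'I_n.+1 -> R) :
  ivar s DIM = n.+1 ->
  (forall (k : 'I_n.+1) acc,
    halts body (State (upd (ivar s) IDX k) (upd (rvar s) x acc) (array s)) T
      (eq (State (upd (ivar s) IDX k) (upd (rvar s) x (op (F k) acc)) (array s)))) ->
  halts (sweep x init body) s (n.+1 * (T + rcost init + 13))
    (eq (State (upd (ivar s) IDX n.+1)
               (upd (rvar s) x (\big[op/reval s init]_(i < n.+1) F i)) (array s))).
Proof.
move=> dim step.
pose after k := State (upd (ivar s) IDX k)
  (upd (rvar s) x (\big[op/reval s init]_(i < n.+1 | (i < k)%N) F i)) (array s).
pose I k s' := (k <= n.+1)%N /\ s' = after (n.+1 - k)%N.
have I0 s' : I 0%N s' -> ~~ teval s' (ILt (IVar IDX) (IVar DIM)).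
  by move=> [_ ->]; rewrite /= /upd/= dim subn0 ltnn.
have IS k s' : I k.+1 s' -> teval s' (ILt (IVar IDX) (IVar DIM)) ->
    halts (Seq body (ISet IDX (IAdd (IVar IDX) (IConst 1)))) s' (T + 4) (I k).
  move=> [kn ->] _; apply: halts_seq.
  have jn : (n.+1 - k.+1 < n.+1)%N by rewrite ltn_subrL.
  apply: halts_post (step (Ordinal jn) _) _ => _ <-.
  apply: halts_iset; split; first exact: ltnW.
  have -> : (n.+1 - k = (n.+1 - k.+1).+1)%N by rewrite subSS subSn.
  by rewrite /after (big_prefix_step op _ _ (Ordinal jn)) /= upd_upd /upd/= addn1.
(* Setting x and the index, then n.+1 rounds of a test (3), the body and an
   increment (4), then the failing test. *)
apply: (@halts_le _ ((rcost init).+1 + (2 + (n.+1 * (3 + (T + 4)) + 3)))%N); last first.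
  by rewrite mulnDr; lia.
apply/halts_seq/halts_rset/halts_seq/halts_iset.
have Istart : I n.+1
    (State (upd (ivar s) IDX 0) (upd (rvar s) x (reval s init)) (array s)).
  by split=> //; rewrite /after subnn big_pred0.
apply: halts_post (halts_while I0 IS Istart) _ => s' [stop [k [kn s'E]]].
move: stop; rewrite s'E /= /upd/= dim -leqNgt => kn'.
have -> : k = 0%N by lia.
rewrite /after subn0; congr (State _ (upd _ _ _) _).
by apply: eq_bigl => i; rewrite ltn_ord.
Qed.

Lemma halts_sweep_min x a (y : 'I_n.+1 -> R) s :
  ivar s DIM = n.+1 -> array s a = vec_array y ->
  halts (sweep_min x a) s (n.+1 * 23)
    (eq (State (upd (ivar s) IDX n.+1) (upd (rvar s) x (vmin y)) (array s))).
Proof.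
move=> dim ya.
have -> : vmin y = \big[Order.min/reval s (RGet a (IConst 0))]_(i < n.+1) y i.
  by rewrite /vmin /= ya vec_array0.
apply: (@halts_le _ (n.+1 * (8 + 2 + 13))%N) => //; apply: halts_sweep => // k acc.
apply: (@halts_le _ (4 + 4)%N) => //.
apply: halts_if; rewrite /= /upd/= !eqxx ya vec_array_ord.
  move=> lt; apply: (@halts_le _ 3) => //; apply: halts_rset.
  by rewrite -[X in upd X]/(upd _ _ _) upd_upd /= /upd/= ya vec_array_ord /Order.min lt.
move=> /negbTE ge; apply: (@halts_le _ 1) => //; apply: halts_skip.
by rewrite /Order.min ge.
Qed.

Lemma halts_sweep_max x a (y : 'I_n.+1 -> R) s :
  ivar s DIM = n.+1 -> array s a = vec_array y ->
  halts (sweep_max x a) s (n.+1 * 23)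
    (eq (State (upd (ivar s) IDX n.+1) (upd (rvar s) x (vmax y)) (array s))).
Proof.
move=> dim ya.
have -> : vmax y = \big[Order.max/reval s (RGet a (IConst 0))]_(i < n.+1) y i.
  by rewrite /vmax /= ya vec_array0.
apply: (@halts_le _ (n.+1 * (8 + 2 + 13))%N) => //; apply: halts_sweep => // k acc.
apply: (@halts_le _ (4 + 4)%N) => //.
apply: halts_if; rewrite /= /upd/= !eqxx ya vec_array_ord.
  move=> lt; apply: (@halts_le _ 1) => //; apply: halts_skip.
  by rewrite /Order.max lt.
move=> /negbTE ge; apply: (@halts_le _ 3) => //; apply: halts_rset.
by rewrite -[X in upd X]/(upd _ _ _) upd_upd /= /upd/= ya vec_array_ord /Order.max ge.
Qed.

Lemma halts_sweep_sum x e (F : 'I_n.+1 -> R) s :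
  ivar s DIM = n.+1 ->
  (forall (k : 'I_n.+1) acc,
    reval (State (upd (ivar s) IDX k) (upd (rvar s) x acc) (array s)) e = F k) ->
  halts (sweep_sum x e) s (n.+1 * (rcost e + 17))
    (eq (State (upd (ivar s) IDX n.+1) (upd (rvar s) x (\sum_(i < n.+1) F i))
               (array s))).
Proof.
move=> dim eF.
apply: (@halts_le _ (n.+1 * ((rcost e + 1).+2 + 1 + 13))%N); last by lia.
apply: (halts_sweep (op := +%R)) => // k acc.
by apply: halts_rset; rewrite /= eF upd_upd upd_same.
Qed.

Definition loaded (s : state R) :=
  [/\ ivar s DIM = n.+1, array s 0%N = vec_array pbar & array s 1%N = vec_array b].

Lemma halts_compute_mass s : loaded s ->
  halts compute_mass s (n.+1 * 27)
    (eq (State (upd (ivar s) IDX n.+1)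
               (upd (rvar s) MASS (partition_fun pbar b (rvar s MID))) (array s))).
Proof.
move=> [dim sp sb]; apply: (halts_sweep_sum (e := tilted_entry)) => // k acc.
by rewrite /= /upd/= sp sb !vec_array_ord sub0r.
Qed.

Lemma halts_compute_excess s : loaded s ->
  halts compute_excess s (n.+1 * 32)
    (eq (State (upd (ivar s) IDX n.+1)
               (upd (rvar s) EXCESS (excess pbar b (rvar s BETA) (rvar s MID)))
               (array s))).
Proof.
move=> [dim sp sb].
apply: (halts_sweep_sum (e := RMul tilted_entry (RSub b_entry (RVar BETA)))) => // k acc.
by rewrite /= /upd/= sp sb !vec_array_ord sub0r.
Qed.

(** The invariant of the bisection loop. *)
Record bracketing (s : state R) : Prop := Bracketing {
  bracketing_loaded : loaded s;
  bracketing_beta : rvar s BETA = beta;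
  bracketing_delta : rvar s DELTA = delta;
  bracketing_bmax : rvar s BMAX = vmax b;
  bracketing_lo_ge0 : 0 <= rvar s LO;
  bracketing_lo_le_hi : rvar s LO <= rvar s HI;
  bracketing_lo : 0 <= excess pbar b beta (rvar s LO);
  bracketing_hi : excess pbar b beta (rvar s HI) <= 0 }.

Lemma halts_halve s : bracketing s ->
  halts halve s (n.+1 * 45) (fun s' => bracketing s' /\
    rvar s' HI - rvar s' LO = (rvar s HI - rvar s LO) / 2).
Proof.
move=> [sld sb sd sm lo0 lohi elo ehi]; case: (sld) => dim sp sbb.
(* The budget lists the costs of the successive statements. *)
apply: (@halts_le _ (6 + (n.+1 * 32 + (3 + 2)))%N); last by lia.
apply/halts_seq/halts_rset/halts_seq.
set s1 := State _ _ _.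
have s1ld : loaded s1 by [].
apply: halts_post (halts_compute_excess s1ld) _ => _ <-.
apply: halts_if => /=; rewrite /upd/= sb -?ltNge => ex; apply: halts_rset.
  by split; [split; rewrite /= /upd/= //; lra|rewrite /= /upd/=; lra].
by split; [split; rewrite /= /upd/= //; lra|rewrite /= /upd/=; lra].
Qed.

(** The enclosure halves at each iteration, so [K] iterations suffice to bring it
    from [delta * 2^K] down to [delta]. *)
Lemma halts_bisect s K : bracketing s ->
  vmax b * (rvar s HI - rvar s LO) <= delta * 2 ^+ K ->
  halts bisect s (n.+1 * (52 * K + 7)) (fun s' => bracketing s' /\
    vmax b * (rvar s' HI - rvar s' LO) <= delta).
Proof.
move=> br sK.
pose I k s' := bracketing s' /\
  vmax b * (rvar s' HI - rvar s' LO) <= delta * 2 ^+ k.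
have widthE s' : bracketing s' -> teval s' (RLt (RVar DELTA) width) =
    (delta < vmax b * (rvar s' HI - rvar s' LO)).
  by move=> [_ _ sd sm _ _ _ _]; rewrite /= sd sm.
have I0 s' : I 0%N s' -> ~~ teval s' (RLt (RVar DELTA) width).
  by move=> [br' le]; rewrite widthE// -leNgt; rewrite expr0 mulr1 in le.
have IS k s' : I k.+1 s' -> teval s' (RLt (RVar DELTA) width) ->
    halts halve s' (n.+1 * 45) (I k).
  move=> [br' le] _; apply: halts_post (halts_halve br') _ => s2 [br2 w2].
  by split=> //; rewrite w2; rewrite exprS in le; lra.
apply: (@halts_le _ (K * (7 + n.+1 * 45) + 7)%N); last by nia.
have Is : I K s by [].
apply: halts_post (halts_while I0 IS Is) _ => s' [stop [k [br' _]]].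
by split=> //; move: stop; rewrite widthE// -leNgt.
Qed.

Lemma halts_report s : bracketing s ->
  halts report s (n.+1 * 50) (fun s' =>
    rvar s' DLO = dual pbar b beta (rvar s LO) /\
    rvar s' DHI = rvar s' DLO + vmax b * (rvar s HI - rvar s LO)).
Proof.
move=> [sld sb sd sm lo0 lohi elo ehi]; case: (sld) => dim sp sbb.
apply: (@halts_le _ (2 + (n.+1 * 27 + (9 + 8)))%N); last by lia.
apply/halts_seq/halts_rset/halts_seq.
set s1 := State _ _ _.
have s1ld : loaded s1 by [].
apply: halts_post (halts_compute_mass s1ld) _ => _ <-.
apply/halts_seq/halts_rset/halts_rset; rewrite /= /upd/= sb sm.
by rewrite /dual sub0r.
Qed.

Hypotheses (pbar_simplex : simplex pbar) (pbar_gt0 : forall i, 0 < pbar i).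
Hypotheses (b_ge0 : forall i, 0 <= b i) (beta_ge0 : 0 <= beta).
Hypotheses (delta_ge0 : 0 <= delta) (b_lt_beta : vmin b < beta).

Lemma halts_projection_solver K :
  vmax b * (ln (vmin pbar)^-1 / (beta - vmin b)) <= delta * 2 ^+ K ->
  halts projection_solver (input pbar b beta delta) (n.+1 * (52 * K + 200))
    (fun s => delta_accurate pbar b beta delta (rvar s DLO) (rvar s DHI)).
Proof.
move=> widthK.
have bmax_ge0 : 0 <= vmax b by apply: le_trans (b_ge0 ord0) (vmax_ge b ord0).
apply: (@halts_le _ (n.+1 * 23 + (n.+1 * 23 + (n.+1 * 23 + (2 + (n.+1 * 32 +
  (3 + (2 + (9 + (n.+1 * (52 * K + 7) + n.+1 * 50)))))))))%N); last by nia.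
apply: halts_seq.
apply: halts_post (halts_sweep_min (y := b) BMIN _ _) _ => // _ <-.
apply: halts_seq.
apply: halts_post (halts_sweep_max (y := b) BMAX _ _) _ => // _ <-.
apply: halts_seq.
apply: halts_post (halts_sweep_min (y := pbar) PMIN _ _) _ => // _ <-.
apply/halts_seq/halts_rset/halts_seq.
set s1 := State _ _ _.
have s1ld : loaded s1 by [].
apply: halts_post (halts_compute_excess s1ld) _ => _ <-.
apply: halts_if; rewrite /= /upd/= => ex.
  apply: (@halts_le _ (2 + 2)) => //; apply/halts_seq/halts_rset/halts_rset.
  rewrite /= /upd/=; split; last by rewrite subrr.
  exists 0; rewrite !lexx; split=> //; rewrite -(dual0 b beta pbar_simplex).
  by apply: dual_value => //; rewrite mul0r.
have [|A0 exA] := excess_upper_end pbar_simplex pbar_gt0 b_lt_beta.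
  by rewrite ltNge.
apply/halts_seq/halts_rset/halts_seq/halts_rset/halts_seq.
set s2 := State _ _ _.
have br : bracketing s2.
  by split; rewrite /= /upd/= ?div1r// ltW// ltNge.
have wK : vmax b * (rvar s2 HI - rvar s2 LO) <= delta * 2 ^+ K.
  by rewrite /= /upd/= div1r subr0.
apply: halts_post (halts_bisect br wK) _ => s3 [br3 w3].
apply: halts_post (halts_report br3) _ => s4 [-> ->].
case: br3 => _ _ _ _ lo0 lohi elo ehi; split; last by lra.
exact: projection_value_bracket.
Qed.

End Program.

(** * The number of halvings *)

(** This is [e <= 2^2], in the form [e^(1/2) <= 2]. *)
Lemma le_exp2_of_ln (R : realType) (x : R) (K : nat) :
  2 * ln x <= K%:R -> x <= 2 ^+ K.
Proof.
move=> lnxK; have [x0|x0] := ltP 0 x; last first.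
  by apply: le_trans x0 _; rewrite exprn_ge0.
have half : expR (2^-1 : R) <= 2.
  rewrite -[leRHS]invrK -[2^-1 in leLHS]opprK expRN lef_pV2 ?posrE ?expR_gt0 ?invr_gt0//.
  by have := expR_ge1Dx (- 2^-1 : R); lra.
rewrite -(lnK x0); apply: (@le_trans _ _ (expR (K%:R * 2^-1))).
  by rewrite ler_expR; lra.
by rewrite expRM_natl lerXn2r// ?nnegrE ?expR_ge0.
Qed.

(** Each entry costs [A] per halving and [B] outside of the loop; the latter is
    absorbed because [1 <= L]. *)
Lemma linear_cost_le (R : realType) (A B S K : nat) (L : R) :
  1 <= L -> K%:R <= 3 * L ->
  (S * (A * K + B))%:R <= (3 * A + B)%:R * (S%:R * L).
Proof.
move=> L1 K3L; rewrite natrM mulrCA ler_wpM2l//.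
rewrite (natrD _ (A * K)) (natrD _ (3 * A)) !natrM mulrDl.
apply: lerD; last by rewrite ler_peMr.
by rewrite [3%:R * A%:R]mulrC -mulrA ler_wpM2l.
Qed.

Theorem theorem6 (R : realType) :
  exists (c : prog) (C : R), 0 < C /\
    forall (n : nat) (pbar b : 'I_n.+1 -> R) (beta delta omega : R),
      simplex pbar -> (forall i, 0 < pbar i) -> (forall i, 0 <= b i) ->
      0 <= beta -> 0 < delta -> 0 < omega -> vmin b + omega <= beta ->
      exists t : nat, solves_in_time c pbar b beta delta t /\
        t%:R <= C * time_bound pbar b delta omega.
Proof.
(* A halving costs at most 52 steps per entry, the rest of the run 200, and there
   are at most 3 L halvings. *)
exists projection_solver, (3 * 52 + 200)%:R; split=> [|n pbar b beta delta omega].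
  by rewrite ltr0n.
move=> simp p0 b0 beta0 delta0 omega0 gap.
have b_lt : vmin b < beta by lra.
rewrite /time_bound; set X := _ / (delta * omega); set L := Num.max _ _.
have L1 : 1 <= L by rewrite le_max lexx.
have LX : ln X <= L by rewrite le_max lexx orbT.
have [K [K3L LK]] : exists K : nat, K%:R <= 3 * L /\ 2 * L <= K%:R.
  have /andP[Kle Kgt] : (Num.truncn (2 * L))%:R <= 2 * L < (Num.truncn (2 * L)).+1%:R.
    by apply: truncn_itv; lra.
  by exists (Num.truncn (2 * L)).+1; split; [rewrite -natr1; lra|exact: ltW].
have XK : X <= 2 ^+ K by apply: le_exp2_of_ln; lra.
have bmax0 : 0 <= vmax b by apply: le_trans (b0 ord0) (vmax_ge b ord0).
have lnp0 := ln_vmin_inv_ge0 simp p0.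
have widthK : vmax b * (ln (vmin pbar)^-1 / (beta - vmin b)) <= delta * 2 ^+ K.
  apply: le_trans (ler_wpM2l (ltW delta0) XK).
  rewrite [leRHS](_ : _ = vmax b * (ln (vmin pbar)^-1 / omega)); last first.
    by rewrite /X; field; rewrite !gt_eqF.
  apply: ler_wpM2l => //; apply: ler_wpM2l => //.
  by rewrite lef_pV2 ?posrE ?subr_gt0// lerBrDl.
have [t [s [run tle acc]]] :=
  halts_projection_solver simp p0 b0 beta0 (ltW delta0) b_lt widthK.
exists t; split; first by exists s.
apply: (@le_trans _ _ (n.+1 * (52 * K + 200))%:R); first by rewrite ler_nat.
exact: linear_cost_le.
Qed.
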